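(* Let $P$ be a tree poset of height $k$, let $q\geq k$ and $\ell$ be positive integers and $\varepsilon>0$. Then there exists $\gamma=\gamma(\varepsilon,q,\ell)>0$ such that, for $n$ sufficiently large, the following holds for every $v\in P$ and every poset homomorphism $\mathrm{r}:P\to[q]$. Let $\mathcal{F}\subseteq\widetilde{\mathcal{B}}_n$ be an $\ell$-gapped family with $\mu(\mathcal{F})\geq q-1+\varepsilon$, and let $\Gamma$ be a $(\frac{\gamma}{2},\ell,\mathcal{F})$-bounded family. Then there is $F\in\mathcal{F}$ such that the number of injective induced homomorphisms $\varphi:P\to\mathcal{F}$ with $\varphi(P)\notin\Gamma$ and $\varphi(v)=F$ is at least $$\left(\frac{\gamma}{2}\right)^{|P|-1}\prod_{xy\in H(P)}n^{\ell|\mathrm{r}(y)-\mathrm{r}(x)|}.$$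
   Context: $\widetilde{\mathcal{B}}_n=\{F\subseteq[n]: |\,|F|-n/2\,|<2\sqrt{n\ln n}\}$. A tree poset is a finite poset whose Hasse diagram is a tree; height is the largest number of elements in a chain; $|P|$ is the number of elements. $H(P)$ is the directed Hasse diagram: an edge $xy$ from $x$ to $y$ when $x<_P y$ and no $z$ satisfies $x<_P z<_P y$. Here $[q]$ carries the reverse of the natural order, so a poset homomorphism $\mathrm{r}:P\to[q]$ means $x<_P y\Rightarrow \mathrm{r}(x)>\mathrm{r}(y)$. An injective induced homomorphism $\varphi:P\to\mathcal{F}$ is an injective map with $\varphi(x)\subsetneq\varphi(y)$ iff $x<_P y$; $\varphi(P)$ is its image. $\mu(\mathcal{F})=\sum_{F\in\mathcal{F}}1/\binom{n}{|F|}$. $\mathcal{F}$ is $\ell$-gapped if $|G\setminus F|\ge\ell$ whenever $F,G\in\mathcal{F}$ and $F\subsetneq G$. For an $\ell$-gapped $\mathcal{F}$, a collection $\Gamma\subseteq2^{\mathcal{F}}$ is $(\gamma,\ell,\mathcal{F})$-bounded if (1) $\{F\}\notin\Gamma$ for every $F\in\mathcal{F}$, and (2) for every $\mathcal{D}\notin\Gamma$, the number of $F\in\mathcal{F}$ with $\{F\}\cup\mathcal{D}\in\Gamma$ is less than $\gamma n^{\ell}$. *)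

(* Defs.v *)
From Stdlib Require Import Reals.
From HB Require Import structures.
From mathcomp Require Import all_boot all_order all_algebra.
From mathcomp Require Import Rstruct.
Set Implicit Arguments. Unset Strict Implicit. Unset Printing Implicit Defensive.
Import Order.TTheory GRing.Theory Num.Theory.
Local Open Scope ring_scope.

Section Poset.
Variables (T : finType) (lt : rel T).

Definition strict_porder : Prop := irreflexive lt /\ transitive lt.

Definition covers (x y : T) : bool := lt x y && [forall z, ~~ (lt x z && lt z y)].

Definition hasse_adj : rel T := fun x y => covers x y || covers y x.

Definition is_tree_poset : Prop :=
  (forall x y : T, connect hasse_adj x y) /\
  (forall s : seq T, (3 <= size s)%N -> uniq s -> ~~ cycle hasse_adj s).

Definition is_chain (S : {set T}) : bool :=
  [forall x in S, forall y in S, [|| x == y, lt x y | lt y x]].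

Definition height : nat := \max_(S : {set T} | is_chain S) #|S|.

(* homomorphism into [q] = {1,...,q} carrying the reverse of the natural order *)
Definition rev_hom (q : nat) (r : T -> nat) : Prop :=
  (forall x, (1 <= r x <= q)%N) /\ (forall x y, lt x y -> (r y < r x)%N).

End Poset.

Section Families.
Variable n : nat.

Definition Btilde : {set {set 'I_n}} :=
  [set F : {set 'I_n} | `| (#|F|%:R : R) - n%:R / 2 | < 2 * sqrt (n%:R * ln n%:R)].

Definition lubell (calF : {set {set 'I_n}}) : R :=
  \sum_(F in calF) ('C(n, #|F|)%:R : R)^-1.

Definition gapped (l : nat) (calF : {set {set 'I_n}}) : Prop :=
  forall F G : {set 'I_n}, F \in calF -> G \in calF -> F \proper G -> (l <= #|G :\: F|)%N.

Definition gl_bounded (gam : R) (l : nat) (calF : {set {set 'I_n}})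
    (Gam : {set {set {set 'I_n}}}) : Prop :=
  [/\ Gam \subset powerset calF,
      (forall F : {set 'I_n}, F \in calF -> [set F] \notin Gam) &
      (forall D : {set {set 'I_n}}, D \subset calF -> D \notin Gam ->
         (#|[set F in calF | (F |: D) \in Gam]|%:R : R) < gam * n%:R ^+ l)].

Definition ind_inj_hom (T : finType) (lt : rel T) (calF : {set {set 'I_n}})
    (phi : {ffun T -> {set 'I_n}}) : bool :=
  [&& injectiveb phi, [forall x, phi x \in calF] &
      [forall x, forall y, (phi x \proper phi y) == lt x y]].

Definition img (T : finType) (phi : {ffun T -> {set 'I_n}}) : {set {set 'I_n}} :=
  [set phi x | x : T].

End Families.

(* Main.v *)
Require Import Defs.
From Stdlib Require Import Reals Lra.
From HB Require Import structures.
From mathcomp Require Import all_boot all_order all_algebra all_fingroup.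
From mathcomp Require Import Rstruct zify ring lra.
Set Implicit Arguments. Unset Strict Implicit. Unset Printing Implicit Defensive.
Import Order.TTheory GRing.Theory Num.Theory.

(** A uniformly random permutation of [[n]] gives a random full chain, whose initial
    segments meet F in a random increasing sequence with expected length mu(F).  A
    chain meeting F in X members has at least X - q + 1 windows of q consecutive
    members, so there are on average at least eps windows.  Discarding every pair
    (A, i) such that A occupies position i of a surviving window on only a small
    proportion of the chains through A leaves a nonempty set G of pairs, and each
    (A, i) in G occupies position i of a window inside G on a positive proportion d
    of the chains through A.

    Fix (A, i) in G and a position j.  By gappedness a window through (A, i) has at
    position j a set B whose size differs from |A| by at least l|i - j|, and a given B
    lies on only an O(n^(-l|i-j|)) fraction of the chains through A, so there are at
    least of order n^(l|i-j|) choices of B.  Since the sizes in F differ by o(n), all but o(1) of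
    the chains through A give a B whose only comparabilities with boundedly many
    prescribed members of F are those forced by A.  Hence the tree can be embedded
    leaf by leaf, the image being induced at every step, and the boundedness of
    Gamma excludes at most half of the choices each time. *)

(** * Windows in a random sequence *)

Section Cleaning.
Local Open Scope ring_scope.
Variables (K : realFieldType) (W X : finType) (x0 : X) (q : nat).
Variable s : W -> seq X.
Hypothesis s_uniq : forall w, uniq (s w).

Definition window_in (G : {set X * 'I_q}) (w : W) (t : nat) : bool :=
  (t + q <= size (s w))%N && [forall c : 'I_q, (nth x0 (s w) (t + c), c) \in G].

(** The element [x] sits at position [c] of a window of [w] inside [G]. The test on [index] makes
    the truncated subtraction a true starting point. *)
Definition through (G : {set X * 'I_q}) (x : X) (c : 'I_q) (w : W) : bool :=
  [&& x \in s w, (c <= index x (s w))%N & window_in G w (index x (s w) - c)].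

(** Windows spoiled by [B], counted by starting point. If [s w] has fewer than [q] terms,
    [size (s w) + 1 - q] truncates to 0 and no window exists. *)
Let nbad (B : {set X * 'I_q}) w :=
  count (predC (window_in (~: B) w)) (iota 0 (size (s w) + 1 - q)).

(** A window spoiled by the new pair alone has [x] at position [c]. Since [s w] has no repetition,
    it must start at [index x (s w) - c], so each [w] loses at most one further window. *)
Lemma nbadU1 B x c w : (nbad ((x, c) |: B) w <= nbad B w + through (~: B) x c w)%N.
Proof.
rewrite /nbad; set r := iota _ _.
have -> : (count (predC (window_in (~: B) w)) r = \sum_(t <- r) ~~ window_in (~: B) w t)%N.
  by rewrite -sum1_count big_mkcond; apply: eq_bigr => t _ /=; case: window_in.
have -> : (count (predC (window_in (~: ((x, c) |: B)) w)) r = \sum_(t <- r) ~~ window_in (~: ((x, c) |: B)) w t)%N.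
  by rewrite -sum1_count big_mkcond; apply: eq_bigr => t _ /=; case: window_in.
have Hth : (\sum_(t <- r) (through (~: B) x c w && (t == index x (s w) - c))
             <= through (~: B) x c w)%N.
  case: (through _ _ _ _); last by rewrite big1.
  rewrite /= (_ : \sum_(t <- r) _ = count_mem (index x (s w) - c)%N r)%N.
    by rewrite count_uniq_mem ?iota_uniq // leq_b1.
  rewrite -sum1_count [RHS]big_mkcond; apply: eq_bigr => t _ /=.
    by case: (t == _).
apply: leq_trans (leq_add (leqnn _) Hth); rewrite -big_split /=.
rewrite big_seq [leqRHS]big_seq; apply: leq_sum => t; rewrite mem_iota => /andP[_ lt_t].
have tq : (t + q <= size (s w))%N by lia.
rewrite /window_in tq /=.
case: (boolP [forall c0 : 'I_q, _ \in ~: B]) => [/forallP Hg|_]; last by case: negb.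
rewrite negb_forall /=; case: existsP => [[c0]|] //=.
rewrite !inE negb_or negb_and !negbK; move: (Hg c0); rewrite inE => /negPf ->.
rewrite orbF => /eqP[ex ec]; subst c0.
have tc : (t + c < size (s w))%N by have := ltn_ord c; lia.
have ix : index x (s w) = (t + c)%N by rewrite -ex index_uniq.
rewrite /through -{1}ex mem_nth //= ix leq_addl addnK eqxx /window_in tq /= andbT.
by have -> : [forall c0 : 'I_q, (nth x0 (s w) (t + c0), c0) \in ~: B] by apply/forallP.
Qed.

Definition deg (x : X) : nat := #|[set w | x \in s w]|.

Lemma sum_deg : (\sum_x deg x = \sum_w size (s w))%N.
Proof.
rewrite (eq_bigr (fun x => \sum_w (x \in s w))%N) => [|x _]; last first.
  by rewrite /deg -sum1_card big_mkcond; apply: eq_bigr => w _; rewrite inE; case: (_ \in _).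
rewrite exchange_big; apply: eq_bigr => w _.
rewrite -(card_uniqP (s_uniq w)) -sum1_card [RHS]big_mkcond.
by apply: eq_bigr => x _; case: (_ \in _).
Qed.

(* Pairs (x, c) through which only a small proportion of the windows pass are
   discarded greedily; a maximal discarded set cannot exhaust all windows. *)
Lemma cleaning (d : K) : (0 < q)%N -> 0 <= d ->
  d * q%:R * (\sum_w size (s w))%:R
    < (\sum_w size (s w))%:R - (q%:R - 1) * #|W|%:R ->
  exists G : {set X * 'I_q},
    (exists w t, window_in G w t) /\
    forall x c, (x, c) \in G ->
      d * (deg x)%:R <= #|[set w | through G x c w]|%:R.
Proof.
move=> q_gt0 d0 Hd.
(* Spoiled windows are charged, at rate [d], to the degrees of the discarded pairs. *)
pose inv (B : {set X * 'I_q}) :=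
  (\sum_w nbad B w)%:R <= d * (\sum_(p in B) deg p.1)%:R.
have inv0 : inv set0.
  rewrite /inv big_set0 mulr0 big1 // => w _; apply/eqP.
  rewrite -leqn0 leqNgt -has_count; apply/hasPn => t; rewrite mem_iota => /andP[_ lt_t].
  rewrite /= negbK /window_in; apply/andP; split; first by lia.
  by apply/forallP => c; rewrite !inE.
case: (@arg_maxnP _ set0 inv (fun B => #|B|) inv0) => B invB maxB.
exists (~: B); split; last first.
  (* A surviving pair with too few windows could be discarded too, against the maximality of [B]. *)
  move=> x c; rewrite inE => xcB; rewrite leNgt; apply/negP => lt_th.
  have : inv ((x, c) |: B).
    rewrite /inv big_setU1 //= natrD mulrDr addrC.
    apply: le_trans (lerD invB (ltW lt_th)).
    rewrite -natrD ler_nat -sum1_card big_mkcond [X in (_ + X)%N]big_mkcond -big_split /=.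
    apply: leq_sum => w _; rewrite inE.
    by apply: leq_trans (nbadU1 _ _ _ _) _; case: through.
  by move=> /maxB; rewrite /= cardsU1 xcB ltnn.
have [/existsP[w /hasP[t _ Ht]]|] := boolP [exists w, has (window_in (~: B) w)
    (iota 0 (size (s w) + 1 - q))]; first by exists w, t.
rewrite negb_exists => /forallP none; exfalso.
(* If every window is spoiled, [nbad] counts all of them, and a sequence has at least its length
   minus [q - 1] windows. *)
have bad w : (size (s w) <= nbad B w + q.-1)%N.
  move: (none w); rewrite -all_predC all_count size_iota => /eqP; rewrite /nbad => ->.
  lia.
have le1 : (\sum_w size (s w))%:R <= (\sum_w nbad B w)%:R + (q%:R - 1) * #|W|%:R :> K.
  have -> : q%:R - 1 = q.-1%:R :> K by rewrite -{1}(prednK q_gt0) -natr1 addrK.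
  rewrite -natrM -natrD ler_nat mulnC -sum_nat_const -big_split /=.
  by apply: leq_sum => w _; apply: bad.
have le2 : (\sum_(p in B) deg p.1)%:R <= q%:R * (\sum_w size (s w))%:R :> K.
  rewrite -natrM ler_nat -sum_deg big_distrr /=.
  apply: (@leq_trans (\sum_(p : X * 'I_q) deg p.1)%N).
    by rewrite [leqRHS](bigID (mem B)) /= leq_addr.
  rewrite -(pair_bigA _ (fun x (_ : 'I_q) => deg x)) /=.
  by apply: leq_sum => x _; rewrite sum_nat_const card_ord.
have le3 := ler_wpM2l d0 le2.
by move: invB; rewrite /inv; lra.
Qed.
End Cleaning.

(** * Symmetry counts for permutations *)

Section Perms.
Variable I : finType.
Implicit Types (s : {perm I}) (A B D : {set I}).

Lemma imset_mulg s t A : (s * t)%g @: A = t @: (s @: A).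
Proof. by rewrite -imset_comp; apply: eq_imset => x; rewrite /= permM. Qed.

Section Equivariant.
Variables (D : {set I}) (P : {set I} -> {set {perm I}}).
Hypothesis P_tperm : forall A a b s,
  A \subset D -> a \in D -> b \in D -> s \in P A -> (s * tperm a b)%g \in P (tperm a b @: A).

Lemma tperm_sub A a b : A \subset D -> a \in D -> b \in D -> tperm a b @: A \subset D.
Proof.
move=> /subsetP AD aD bD; apply/subsetP => _ /imsetP[x xA ->].
by case: tpermP => *; rewrite ?aD ?bD // AD.
Qed.

(** Swapping some [a] of [A :\: B] with some [b] of [B :\: A] injects [P A] into [P] of the swapped
    set, which is closer to [B]; iterate until [B] is reached. *)
Lemma card_tperm_le A B : A \subset D -> B \subset D -> #|A| = #|B| -> #|P A| <= #|P B|.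
Proof.
have [m] := ubnP #|A :\: B|; elim: m A => // m IH A ltm AD BD AB.
have [/eqP|[a aA]] := set_0Vmem (A :\: B).
  rewrite setD_eq0 => sAB.
  by have /eqP -> : A == B; rewrite ?leqnn // eqEcard sAB AB leqnn.
have [e|[b bB]] := set_0Vmem (B :\: A).
  have sBA : B \subset A by rewrite -setD_eq0 e.
  have eBA : B = A by apply/eqP; rewrite eqEcard sBA AB leqnn.
  by rewrite eBA leqnn.
move: aA bB; rewrite !inE => /andP[aB aA] /andP[bA bB].
have aD := subsetP AD a aA; have bD := subsetP BD b bB.
pose t := tperm a b.
have leA : #|P A| <= #|P (t @: A)|.
  rewrite -(card_imset _ (mulIg t)); apply/subset_leq_card/subsetP => _ /imsetP[s sP ->].
  exact: P_tperm.
apply: leq_trans leA _; apply: IH; rewrite ?tperm_sub ?card_imset //; last exact: perm_inj.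
rewrite -ltnS; apply: leq_trans ltm; rewrite ltnS; apply: proper_card; apply/properP; split.
  apply/subsetP => x; rewrite !inE => /andP[xB /imsetP[y yA ex]]; rewrite xB /=.
  move: xB yA; rewrite ex /t; case: tpermP => [_|->|_ _]; rewrite ?bB ?(negPf bA) //.
exists a; rewrite !inE ?aB ?aA //=; apply/negP => /imsetP[y yA ey].
by move: (yA); rewrite -(tpermK a b y) -/t -ey /t tpermL (negPf bA).
Qed.

Lemma card_tperm A B : A \subset D -> B \subset D -> #|A| = #|B| -> #|P A| = #|P B|.
Proof. by move=> AD BD AB; apply/eqP; rewrite eqn_leq !card_tperm_le. Qed.

Variable Q : {set {perm I}}.
Hypothesis P_disj : forall A B s,
  A \subset D -> B \subset D -> #|A| = #|B| -> s \in P A -> s \in P B -> A = B.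

(** Double counting of the pairs [(s, B)] with [s] in [P B]: by symmetry each [B] in [D] of the size
    of [A] contributes [#|P A|]. *)
Lemma sum_draw A : A \subset D ->
  #|P A| * 'C(#|D|, #|A|) =
    \sum_s #|[set B : {set I} | [&& B \subset D, #|B| == #|A| & s \in P B]]|.
Proof.
move=> AD; rewrite -cards_draws mulnC -sum_nat_const.
rewrite (eq_bigr (fun B => #|P B|)) => [|B]; last first.
  by rewrite inE => /andP[BD /eqP BA]; apply: card_tperm.
under eq_bigr do rewrite -sum1_card.
rewrite (exchange_big_dep predT) //=; apply: eq_bigr => s _.
by rewrite -[RHS]sum1_card; apply: eq_bigl => B; rewrite !inE andbA.
Qed.

(** By disjointness each [s] in [Q] lies in at most one [P B], and each [s] outside [Q] lies in
    none. *)
Lemma card_draw_le A : A \subset D ->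
  (forall B, B \subset D -> #|B| = #|A| -> P B \subset Q) ->
  #|P A| * 'C(#|D|, #|A|) <= #|Q|.
Proof.
move=> AD PQ; rewrite sum_draw // -[leqRHS]sum1_card [leqRHS]big_mkcond /=; apply: leq_sum => s _.
case: ifPn => [_|sQ].
  apply/card_le1_eqP => B B'; rewrite !inE => /and3P[BD /eqP BA sB] /and3P[BD' /eqP BA' sB'].
  by apply: (P_disj _ _ _ sB' sB) => //; rewrite BA BA'.
rewrite leqn0 cards_eq0; apply/eqP/setP => B; rewrite !inE; apply/negP.
move=> /and3P[BD /eqP BA sB]; case/negP: sQ.
exact: subsetP (PQ B BD BA) _ sB.
Qed.

Lemma card_draw_ge A : A \subset D ->
  (forall s, s \in Q -> exists B, [&& B \subset D, #|B| == #|A| & s \in P B]) ->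
  #|Q| <= #|P A| * 'C(#|D|, #|A|).
Proof.
move=> AD QP; rewrite sum_draw // -[leqLHS]sum1_card big_mkcond /=; apply: leq_sum => s _.
case: ifPn => [/QP[B HB]|//]; rewrite card_gt0; apply/set0Pn; exists B; by rewrite inE.
Qed.

End Equivariant.
End Perms.

(** * Union bound and binomial estimates *)

Lemma card_exists_le (J T : finType) (Z : {set J}) (P : J -> pred T) :
  #|[set t | [exists z in Z, P z t]]| <= \sum_(z in Z) #|[set t | P z t]|.
Proof.
under eq_bigr do rewrite -sum1dep_card.
rewrite (exchange_big_dep predT) //= -sum1dep_card big_mkcond /=.
apply: leq_sum => t _; case: existsP => // -[z /andP[zZ Pz]].
by rewrite sum1dep_card card_gt0; apply/set0Pn; exists z; rewrite inE zZ.
Qed.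

Lemma leq_bin_half (N m d : nat) : m <= d -> d.*2 <= N -> 'C(N, m) <= 'C(N, d).
Proof.
elim: d => [|d IH]; first by rewrite leqn0 => /eqP ->.
rewrite leq_eqVlt ltnS => /orP[/eqP -> //|md] dN.
apply: leq_trans (IH md _) _; first by lia.
rewrite -(@leq_pmul2l d.+1) // mul_bin_left leq_mul2r; apply/orP; right; lia.
Qed.

(** Since [N >= n/4] and [m <= d <= n/8], the factors of [N ^_ m] are at least [N - m >= n/8].
    Moreover [2d <= N], so passing from ['C(N, m)] to ['C(N, d)] only increases. The constant is
    uniform in [m <= M]. *)
Lemma leq_expn_bin (n N m d M : nat) : m <= d -> m <= M -> n <= 4 * N -> 8 * d <= n ->
  n ^ m <= 8 ^ M * M`! * 'C(N, d).
Proof.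
move=> md mM nN dn.
have le1 : (N - m) ^ m <= N ^_ m.
  elim: (m) => // p IH; rewrite ffactnSr expnSr leq_mul ?leq_sub2l //.
  apply: leq_trans IH; case: p => // p; rewrite leq_exp2r //; lia.
have le2 : n ^ m <= 8 ^ m * (N - m) ^ m.
  rewrite -expnMn; case: (m) md dn => // p md dn; rewrite leq_exp2r //; lia.
apply: leq_trans le2 _; rewrite -mulnA leq_mul ?leq_pexp2l //.
apply: leq_trans le1 _; rewrite -bin_ffact mulnC leq_mul ?leq_bin_half //; last by lia.
exact: leq_fact.
Qed.

(** * Full chains of a random permutation *)

Section Prefix.
Variable n : nat.
Implicit Types (s : {perm 'I_n}) (F G A : {set 'I_n}).

(** As [m] runs from 0 to [n], these sets form the full chain attached to [s]. *)
Definition initial s (m : nat) : {set 'I_n} := s @: [set i : 'I_n | i < m].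

Lemma mem_initial s m i : (s i \in initial s m) = (i < m).
Proof. by rewrite mem_imset ?inE //; apply: perm_inj. Qed.

Lemma card_initial s m : m <= n -> #|initial s m| = m.
Proof.
move=> mn; rewrite card_imset; last exact: perm_inj.
by rewrite -sum1dep_card -(big_ord_widen n (fun=> 1)) // sum1_card card_ord.
Qed.

Lemma initial_mul s t m : initial (s * t)%g m = t @: initial s m.
Proof. exact: imset_mulg. Qed.

Lemma initial_sub s m m' : m <= m' -> initial s m \subset initial s m'.
Proof. by move=> mm; apply/imsetS/subsetP => i; rewrite !inE => /leq_trans; apply. Qed.

(** The permutations whose full chain passes through [F]. *)
Definition flag F : {set {perm 'I_n}} := [set s | initial s #|F| == F].

Lemma flagP s F : reflect (initial s #|F| = F) (s \in flag F).
Proof. by rewrite inE; apply: eqP. Qed.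

Lemma flag_mul s t F : s \in flag F -> (s * t)%g \in flag (t @: F).
Proof.
move=> /flagP sF; apply/flagP; rewrite card_imset ?initial_mul ?sF //; exact: perm_inj.
Qed.

Lemma mem_flag s F i : s \in flag F -> (s i \in F) = (i < #|F|).
Proof. by move=> /flagP sF; rewrite -{1}sF mem_initial. Qed.

Lemma cardsn F : #|F| <= n.
Proof. by rewrite -[leqRHS]card_ord max_card. Qed.

(** Every full chain has a member of size [#|F|], and by symmetry all sets of that size are met
    equally often. *)
Lemma card_flag_ge F : n`! <= #|flag F| * 'C(n, #|F|).
Proof.
have -> : n`! = #|[set: {perm 'I_n}]| by rewrite cardsT card_Sn.
have -> : 'C(n, #|F|) = 'C(#|[set: 'I_n]|, #|F|) by rewrite cardsT card_ord.
apply: (@card_draw_ge _ setT (@flag)); rewrite ?subsetT //.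
  by move=> A a b s _ _ _; apply: flag_mul.
move=> s _; exists (initial s #|F|); rewrite subsetT card_initial ?cardsn // eqxx /=.
by apply/flagP; rewrite card_initial ?cardsn.
Qed.

Lemma flag_gt0 F : 0 < #|flag F|.
Proof. by have := card_flag_ge F; have := fact_gt0 n; case: #|_|; lia. Qed.

Lemma tperm_fix (D F : {set 'I_n}) a b : a \in D -> b \in D -> [disjoint F & D] -> tperm a b @: F = F.
Proof.
move=> aD bD dis; apply/setP => x; apply/imsetP/idP => [[y yF ->]|xF].
  case: tpermP => // e; subst y; by rewrite (disjointFr dis yF) in aD bD *.
exists x => //; case: tpermP => // e; subst x; by rewrite (disjointFr dis xF) in aD bD *.
Qed.

Lemma tperm_fix2 (D : {set 'I_n}) a b : a \in D -> b \in D -> tperm a b @: D = D.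
Proof.
move=> aD bD; apply/eqP; rewrite eqEcard card_imset ?leqnn ?andbT; last exact: perm_inj.
exact: tperm_sub.
Qed.

(** On the chains through [F], the next [#|F'| - #|F|] elements form a uniformly random subset of
    the complement of [F]. *)
Lemma card_flag_up F F' : F \subset F' ->
  #|flag F :&: flag F'| * 'C(n - #|F|, #|F'| - #|F|) <= #|flag F|.
Proof.
move=> FF'.
have -> : n - #|F| = #|~: F| by rewrite [RHS]cardsCs setCK card_ord.
have -> : #|F'| - #|F| = #|F' :\: F| by rewrite cardsD (setIidPr FF').
rewrite -{1}(setID F' F) (setIidPr FF').
apply: (@card_draw_le _ (~: F) (fun A => flag F :&: flag (F :|: A))).
- move=> A a b s _ aF bF; rewrite !in_setI => /andP[sF sA].
  have tF : tperm a b @: F = F by apply: tperm_fix aF bF _; rewrite disjoints_subset setCK.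
  rewrite -{1}tF flag_mul //=.
  by have := flag_mul (tperm a b) sA; rewrite imsetU tF.
- move=> A B s AF BF AB; rewrite !in_setI => /andP[_ /flagP sA] /andP[_ /flagP sB].
  have setUKD (D : {set 'I_n}) : D \subset ~: F -> (F :|: D) :\: F = D.
    by move=> DF; rewrite setDUl setDv set0U setDE; apply/setIidPl.
  have cardUF (D : {set 'I_n}) : D \subset ~: F -> #|F :|: D| = #|F| + #|D|.
    by move=> DF; rewrite cardsU disjoint_setI0 ?cards0 ?subn0 // disjoint_sym disjoints_subset.
  by rewrite -(setUKD A AF) -(setUKD B BF) -sA -sB !cardUF // AB.
- by rewrite setDE subsetIr.
- by move=> B _ _; apply: subsetIl.
Qed.

(** On the chains through [F], the first [#|F'|] elements form a uniformly random subset of [F]. *)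
Lemma card_flag_down F F' : F' \subset F ->
  #|flag F :&: flag F'| * 'C(#|F|, #|F'|) <= #|flag F|.
Proof.
move=> FF'.
apply: (@card_draw_le _ F (fun A => flag F :&: flag A)) => //.
- move=> A a b s _ aF bF; rewrite !in_setI => /andP[sF sA].
  by rewrite -{1}(tperm_fix2 aF bF) !flag_mul.
- by move=> A B s _ _ AB; rewrite !in_setI => /andP[_ /flagP <-] /andP[_ /flagP <-]; rewrite AB.
- by move=> B _ _; apply: subsetIl.
Qed.

(** On the chains through [F], the entry [s i] is uniform on [F] when [i < #|F|] and on its
    complement otherwise; both have at least [N] elements. *)
Lemma card_flag_pos F N (i y : 'I_n) : (i < #|F|) = (y \in F) ->
  N <= #|F| -> N <= n - #|F| ->
  #|[set s | (s \in flag F) && (s i == y)]| * N <= #|flag F|.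
Proof.
move=> iy NF NnF.
pose D := if y \in F then F else ~: F.
have yD : y \in D by rewrite /D; case: ifP => //; rewrite inE => ->.
have ND : N <= #|D|.
  by rewrite /D; case: ifP => // _; rewrite [leqRHS]cardsCs setCK card_ord.
apply: leq_trans (leq_mul (leqnn _) ND) _.
pose P (A : {set 'I_n}) : {set {perm 'I_n}} := [set s in flag F | A == [set s i]].
have -> : #|[set s in flag F | s i == y]| = #|P [set y]|.
  apply: eq_card => s; rewrite !inE; congr (_ && _); apply/eqP/eqP => [->//|/set1_inj //].
rewrite -[#|D|]bin1 -(cards1 y).
apply: (@card_draw_le _ D P) => //; last 2 first.
- by rewrite sub1set.
- by move=> B _ _; apply/subsetP => s; rewrite inE => /andP[].
- move=> A a b s _ aD bD; rewrite !inE => /andP[sF /eqP ->].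
  rewrite imset_set1 permM eqxx andbT.
  have -> : F = tperm a b @: F; last by have := flag_mul (tperm a b) (_ : s \in flag F); rewrite !inE; apply.
  move: aD bD; rewrite /D; case: ifP => _ aD bD; first by rewrite tperm_fix2.
  by rewrite (tperm_fix aD bD) // disjoints_subset setCK.
- by move=> A B s _ _ _; rewrite !inE => /andP[_ /eqP ->] /andP[_ /eqP ->].
Qed.

Lemma card_flag_hit F N (Z : {set 'I_n * 'I_n}) :
  (forall z, z \in Z -> (z.1 < #|F|) = (z.2 \in F)) -> N <= #|F| -> N <= n - #|F| ->
  #|[set s | [exists z in Z, (s \in flag F) && (s z.1 == z.2)]]| * N <= #|Z| * #|flag F|.
Proof.
move=> HZ NF NnF; apply: leq_trans (leq_mul (card_exists_le _ _) (leqnn N)) _.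
rewrite big_distrl -sum_nat_const; apply: leq_sum => z zZ.
by apply: card_flag_pos => //; apply: HZ.
Qed.

End Prefix.

(** * Chains that create no unforced comparability *)

Section Generic.
Variables (n w : nat).
Implicit Types (F G A : {set 'I_n}) (s : {perm 'I_n}).

(** For [F'] above [F], the only comparability with [G] left is the forced one, [G] inside [F]
    inside [F']. [generic_down] is its dual for [F'] below [F]. *)
Definition generic_up F G F' := ~~ (F' \subset G) && ((G \subset F') ==> (G \subset F)).
Definition generic_down F G F' := ~~ (G \subset F') && ((F' \subset G) ==> (F \subset G)).

Lemma card_ord_itv a : #|[set i : 'I_n | a <= i < a + w]| <= w.
Proof.
rewrite -[leqRHS](size_iota a) -[leqRHS](size_map (fun i => i)).
rewrite cardE -(size_map val); apply: uniq_leq_size.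
  by rewrite map_inj_uniq ?enum_uniq //; apply: val_inj.
by move=> x /mapP[i]; rewrite mem_enum inE => ia ->; rewrite map_id mem_iota.
Qed.

Lemma card_ord_eq a : #|[set i : 'I_n | i == a :> nat]| <= 1.
Proof. by apply/card_le1_eqP => i j; rewrite !inE => /eqP ia /eqP ja; apply/val_inj; rewrite /= ia ja. Qed.

(* An initial segment of [s] extending [F] fails to be generic with respect to [G] only if
   [s] reaches a fixed element of [G :\: F] within [w] steps after [F], or its
   first step after [F] stays in [G]. *)
Lemma card_not_generic_up F G N (P : pred {perm 'I_n}) (f : {perm 'I_n} -> {set 'I_n}) :
  N <= #|F| -> N <= n - #|F| -> #|G| <= #|F| + w ->
  (forall s, P s -> [/\ s \in flag F, s \in flag (f s), F \proper f s & #|f s| <= #|F| + w]) ->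
  #|[set s | P s && ~~ generic_up F G (f s)]| * N <= (w + w) * #|flag F|.
Proof.
move=> NF NnF Gw HP.
pose X := if [pick x in G :\: F] is Some x then [set x] else set0.
have X1 : #|X| <= 1 by rewrite /X; case: pickP => [x _|_]; rewrite ?cards1 ?cards0.
have XGF : X \subset G :\: F.
  by rewrite /X; case: pickP => [x xG|_]; rewrite ?sub1set ?sub0set.
(* If [f s] stays inside [G], then so does [F], and the entry right after [F] falls into [G :\: F],
   which has at most [w] elements. *)
pose Y := if F \subset G then G :\: F else set0.
have Yw : #|Y| <= w.
  rewrite /Y; case: ifP => FG; last by rewrite cards0.
  by rewrite cardsD (setIidPr FG); lia.
pose Z := setX [set i : 'I_n | #|F| <= i < #|F| + w] X :|: setX [set i : 'I_n | i == #|F| :> nat] Y.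
have ZF z : z \in Z -> (z.1 < #|F|) = (z.2 \in F).
  rewrite !inE => /orP[/andP[/andP[le _] zX]|/andP[/eqP -> zY]].
    have := subsetP XGF _ zX; rewrite inE => /andP[/negPf -> _]; lia.
  move: zY; rewrite /Y; case: ifP => _; rewrite !inE //.
  by move=> /andP[/negPf -> _]; rewrite ltnn.
have Zw : #|Z| <= w + w.
  apply: leq_trans (leq_card_setU _ _) _; rewrite !cardsX leq_add //.
    by rewrite -[leqRHS]muln1 leq_mul // card_ord_itv.
  by rewrite -[leqRHS]mul1n leq_mul // card_ord_eq.
apply: leq_trans (leq_mul Zw (leqnn _)); apply: leq_trans (card_flag_hit ZF NF NnF).
rewrite leq_mul //; apply/subset_leq_card/subsetP => s; rewrite inE => /andP[/HP[sF sf Ff fw]].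
have sFm := mem_flag _ sF; have sfm := mem_flag _ sf.
rewrite negb_and negbK negb_imply => /orP[fG|/andP[Gf nGF]]; rewrite inE; apply/existsP.
  have lt := proper_card Ff.
  have Fn : #|F| < n by apply: leq_trans lt (cardsn _).
  pose i := Ordinal Fn; exists (i, s i); rewrite sF /= !inE /= !eqxx /= andbT.
  apply/orP; right; rewrite /Y (subset_trans (proper_sub Ff) fG) !inE sFm ltnn /=.
  by apply: (subsetP fG); rewrite sfm.
move: XGF ZF; rewrite /Z /X; case: pickP => [x|none].
  rewrite inE => /andP[xF xG] _ _; exists ((s^-1)%g x, x); rewrite sF /= permKV eqxx andbT.
  move: xF (subsetP Gf x xG); rewrite -{1 2}(permKV s x) sFm sfm => le lt.
  by rewrite !inE /= eqxx leqNgt le (leq_trans lt).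
by case/negP: nGF; apply/subsetP => x xG; move: (none x); rewrite inE xG andbT => /negbFE.
Qed.

(** Mirror image of the upward case: genericity fails only if a fixed element of [F :\: G] sits
    among the last [w] entries of [F], or if the very last entry of [F] lies outside [G] while [G]
    is properly inside [F]. *)
Lemma card_not_generic_down F G N (P : pred {perm 'I_n}) (f : {perm 'I_n} -> {set 'I_n}) :
  N <= #|F| -> N <= n - #|F| -> #|F| <= #|G| + w ->
  (forall s, P s -> [/\ s \in flag F, s \in flag (f s), f s \proper F & #|F| <= #|f s| + w]) ->
  #|[set s | P s && ~~ generic_down F G (f s)]| * N <= (w + w) * #|flag F|.
Proof.
move=> NF NnF Gw HP.
pose X := if [pick x in F :\: G] is Some x then [set x] else set0.
have X1 : #|X| <= 1 by rewrite /X; case: pickP => [x _|_]; rewrite ?cards1 ?cards0.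
have XGF : X \subset F :\: G.
  by rewrite /X; case: pickP => [x xG|_]; rewrite ?sub1set ?sub0set.
pose Y := if G \proper F then F :\: G else set0.
have Yw : #|Y| <= w.
  rewrite /Y; case: ifP => GF; last by rewrite cards0.
  by rewrite cardsD (setIidPr (proper_sub GF)); lia.
(* The range of positions is cut at [#|F|] separately, because [#|F| - w] truncates when
   [#|F| < w]. *)
pose Z := setX [set i : 'I_n | #|F| - w <= i < #|F| - w + w & i < #|F|] X
  :|: setX [set i : 'I_n | i == #|F|.-1 :> nat] Y.
have ZF z : z \in Z -> (z.1 < #|F|) = (z.2 \in F).
  rewrite !inE => /orP[/andP[/andP[_ le] zX]|/andP[/eqP -> zY]].
    by have := subsetP XGF _ zX; rewrite inE le => /andP[_ ->].
  move: zY; rewrite /Y; case: ifP => [/proper_card|_]; rewrite !inE //.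
  by move=> lt /andP[_ ->]; rewrite ltn_predL; exact: leq_ltn_trans lt.
have Zw : #|Z| <= w + w.
  apply: leq_trans (leq_card_setU _ _) _; rewrite !cardsX leq_add //.
    rewrite -[leqRHS]muln1 leq_mul //; apply: leq_trans (card_ord_itv (#|F| - w)).
    by apply/subset_leq_card/subsetP => i; rewrite !inE => /andP[].
  by rewrite -[leqRHS]mul1n leq_mul // card_ord_eq.
apply: leq_trans (leq_mul Zw (leqnn _)); apply: leq_trans (card_flag_hit ZF NF NnF).
rewrite leq_mul //; apply/subset_leq_card/subsetP => s; rewrite inE => /andP[/HP[sF sf Ff fw]].
have sFm := mem_flag _ sF; have sfm := mem_flag _ sf.
have lt := proper_card Ff.
rewrite negb_and negbK negb_imply => /orP[Gf|/andP[fG nGF]]; rewrite inE; apply/existsP.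
  have Fn : #|F|.-1 < n by apply: leq_trans (cardsn F); rewrite ltn_predL (leq_ltn_trans _ lt).
  pose i := Ordinal Fn; exists (i, s i); rewrite sF /= !inE /= !eqxx /= andbT.
  apply/orP; right; rewrite /Y (sub_proper_trans Gf Ff) !inE sFm /=.
  rewrite ltn_predL (leq_ltn_trans _ lt) // andbT.
  by apply/negP => /(subsetP Gf); rewrite sfm /=; move: lt; case: #|F| => //= k; lia.
move: XGF ZF; rewrite /Z /X; case: pickP => [x|none].
  rewrite inE => /andP[xG xF] _ _; exists ((s^-1)%g x, x); rewrite sF /= permKV eqxx andbT.
  have := contra (subsetP fG x) xG.
  move: xF; rewrite -{1 2}(permKV s x) sFm sfm => lt' ge.
  rewrite !inE /= eqxx lt' !andbT; apply/orP; left.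
  by move: lt' ge fw; move: #|F| #|f s| (nat_of_ord _) => a b i; lia.
by case/negP: nGF; apply/subsetP => x xF; move: (none x); rewrite inE xF andbT => /negbFE.
Qed.

End Generic.

(** * The members of a family on a random full chain *)

Section Chain.
Variables (n l : nat) (calF : {set {set 'I_n}}).
Hypothesis gapF : gapped l calF.
Implicit Types (F G A : {set 'I_n}) (s : {perm 'I_n}).

Definition chain s : seq {set 'I_n} := [seq A <- [seq initial s m | m <- iota 0 n.+1] | A \in calF].

Lemma mem_chain s F : (F \in chain s) = (F \in calF) && (s \in flag F).
Proof.
rewrite mem_filter; case: (F \in calF) => //; rewrite !andTb; apply/mapP/flagP => [[m]|<-].
  by rewrite mem_iota add0n ltnS => /andP[_ mn] ->; rewrite card_initial.
by exists #|F| => //; rewrite mem_iota add0n ltnS cardsn.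
Qed.

Lemma chain_sorted s : sorted (fun A B : {set 'I_n} => A \proper B) (chain s).
Proof.
apply: sorted_filter; first by move=> ? ? ?; apply: proper_trans.
apply/(sortedP set0) => i; rewrite size_map size_iota => lt_i.
rewrite !(nth_map 0) ?size_iota ?(ltnW lt_i) // !nth_iota ?(ltnW lt_i) // !add0n.
by rewrite properEcard initial_sub // !card_initial //; lia.
Qed.

Lemma chain_uniq s : uniq (chain s).
Proof.
apply: sorted_uniq (chain_sorted s); first by move=> ? ? ?; apply: proper_trans.
by move=> A; apply: properxx.
Qed.

Lemma chain_nth_proper s i j : i < j < size (chain s) ->
  nth set0 (chain s) i \proper nth set0 (chain s) j.
Proof.
move=> /andP[ij js]; have is' := ltn_trans ij js.
by apply: (sorted_ltn_nth _ _ (chain_sorted s)) => // ? ? ?; apply: proper_trans.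
Qed.

Lemma chain_gap s i j : i <= j < size (chain s) ->
  #|nth set0 (chain s) i| + l * (j - i) <= #|nth set0 (chain s) j|.
Proof.
move=> /andP[ij]; rewrite -(subnKC ij) addKn; elim: (j - i) => [|d IH] js.
  by rewrite muln0 !addn0.
have js' : i + d < size (chain s) by lia.
apply: (@leq_trans (#|nth set0 (chain s) (i + d)| + l)).
  by rewrite mulnS [l + _]addnC addnA leq_add2r IH.
have pr := @chain_nth_proper s (i + d) (i + d.+1) _.
have {}pr : nth set0 (chain s) (i + d) \proper nth set0 (chain s) (i + d.+1).
  by apply: pr; rewrite js andbT; lia.
have inF k : k < size (chain s) -> nth set0 (chain s) k \in calF.
  by move=> /(mem_nth set0); rewrite mem_chain => /andP[].
have := gapF (inF _ js') (inF _ js) pr; rewrite cardsD (setIidPr (proper_sub pr)).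
have := proper_card pr; move: #|_| #|_| => a b; lia.
Qed.

Lemma deg_chain F : F \in calF -> deg chain F = #|flag F|.
Proof. by move=> FF; apply: eq_card => s; rewrite inE mem_chain FF. Qed.

Lemma deg_chain0 F : F \notin calF -> deg chain F = 0.
Proof. by move=> FF; apply: eq_card0 => s; rewrite inE mem_chain (negPf FF). Qed.

(** * Many generic choices for one step along a window *)

Section Step.
Local Open Scope ring_scope.
Variables (K : realFieldType) (d : K) (q w M : nat).
Hypotheses (d_gt0 : 0 < d) (n_gt0 : (0 < n)%N) (lM : (l * q <= M)%N).
Hypothesis cardF : forall A, A \in calF -> (n <= 4 * #|A| /\ n <= 4 * (n - #|A|))%N.
Hypothesis cardFF : forall A B, A \in calF -> B \in calF -> (#|A| <= #|B| + w)%N.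
Hypothesis w_le : (8 * w <= n)%N.
Variable G : {set {set 'I_n} * 'I_q}.
Hypothesis G_thr : forall A c, (A, c) \in G ->
  d * (deg chain A)%:R <= #|[set s | through set0 chain G A c s]|%:R.

(** The member at position [c'] of the window of [s] that has [A] at position [c]. *)
Definition jump (A : {set 'I_n}) (c c' : 'I_q) s : {set 'I_n} :=
  nth set0 (chain s) (index A (chain s) - c + c').

(** All pairs of the window lie in [G], so the new pair is again in [G] and the process can be
    repeated from it; the size bounds come from the gaps between consecutive members. *)
Lemma jumpP A c c' s : through set0 chain G A c s ->
  [/\ jump A c c' s \in calF, (jump A c c' s, c') \in G, s \in flag A, s \in flag (jump A c c' s) &
   ((c < c')%N -> A \proper jump A c c' s /\ (#|A| + l * (c' - c) <= #|jump A c c' s|)%N) /\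
   ((c' < c)%N -> jump A c c' s \proper A /\ (#|jump A c c' s| + l * (c - c') <= #|A|)%N)].
Proof.
move=> /and3P[As cA /andP[sz /forallP Gs]]; rewrite /jump.
set t := (index A (chain s) - c)%N; have tc : index A (chain s) = (t + c)%N by rewrite subnK.
have lt (x : 'I_q) : (t + x < size (chain s))%N.
  by apply: leq_trans sz; rewrite ltn_add2l.
have := mem_nth set0 (lt c'); rewrite mem_chain => /andP[-> ->].
move: (As); rewrite mem_chain => /andP[AF sA]; split => //.
have eA : A = nth set0 (chain s) (t + c) by rewrite -tc nth_index.
split=> cc.
- have h : (t + c < t + c')%N by rewrite ltn_add2l.
  split; first by rewrite {1}eA chain_nth_proper // h lt.
  have := @chain_gap s (t + c) (t + c'); rewrite -eA subnDl; apply.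
  by rewrite ltnW // lt.
- have h : (t + c' < t + c)%N by rewrite ltn_add2l.
  split; first by rewrite {1}eA chain_nth_proper // h lt.
  have := @chain_gap s (t + c') (t + c); rewrite -eA subnDl; apply.
  by rewrite ltnW // lt.
Qed.

Definition generic (c c' : 'I_q) (A B C : {set 'I_n}) : bool :=
  if (c < c')%N then (A \proper C) && generic_up A B C
  else (C \proper A) && generic_down A B C.

Lemma card_not_generic (A B : {set 'I_n}) (c c' : 'I_q) N : A \in calF -> B \in calF -> c != c' ->
  (N <= #|A|)%N -> (N <= n - #|A|)%N ->
  (#|[set s | through set0 chain G A c s && ~~ generic c c' A B (jump A c c' s)]| * N
    <= (w + w) * #|flag A|)%N.
Proof.
move=> AF BF cc NA NnA; rewrite /generic; case: ltnP => lt.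
  rewrite -(@eq_card _ (mem [set s | through set0 chain G A c s
      && ~~ generic_up A B (jump A c c' s)])).
    apply: card_not_generic_up => //; first exact: cardFF.
    move=> s /(jumpP c')[JF _ sA sJ [/(_ lt)[pr _] _]]; split=> //; exact: cardFF.
  move=> s; rewrite !inE; case: (boolP (through _ _ _ _ _ _)) => //=.
  by move=> /(jumpP c')[_ _ _ _ [/(_ lt)[-> _] _]].
have {cc}lt : (c' < c)%N by rewrite ltn_neqAle lt andbT eq_sym; apply: contraNneq cc => /val_inj ->.
rewrite -(@eq_card _ (mem [set s | through set0 chain G A c s
    && ~~ generic_down A B (jump A c c' s)])).
  apply: card_not_generic_down => //; first exact: cardFF.
  move=> s /(jumpP c')[JF _ sA sJ [_ /(_ lt)[pr _]]]; split=> //; exact: cardFF.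
move=> s; rewrite !inE; case: (boolP (through _ _ _ _ _ _)) => //=.
by move=> /(jumpP c')[_ _ _ _ [_ /(_ lt)[-> _]]].
Qed.

(* [|c - c'|]: one of the two truncated differences vanishes. *)
Definition gap (c c' : nat) : nat := (c' - c) + (c - c').

(** Chains that jump from [A] to [B] pass through both sets, hence form at most an inverse binomial
    proportion of those through [A]. The sizes differ by at least [l * gap c c'] and by at most
    [w <= n/8], so that binomial is at least of order [n ^ (l * gap c c')]. *)
Lemma card_jump_fiber (A B : {set 'I_n}) (c c' : 'I_q) : A \in calF -> c != c' ->
  (#|[set s | through set0 chain G A c s && (jump A c c' s == B)]| * n ^ (l * gap c c')
    <= 8 ^ M * M`! * #|flag A|)%N.
Proof.
move=> AF cc.
(* One chain in the fibre suffices to know that [A] and [B] are comparable and far apart in size. *)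
have [->|/set0Pn[s0]] := eqVneq [set s | through set0 chain G A c s && (jump A c c' s == B)] set0.
  by rewrite cards0.
rewrite inE => /andP[/(jumpP c')[JF _ _ _ gapJ] /eqP eB]; rewrite eB in JF gapJ.
have le : (#|[set s | through set0 chain G A c s && (jump A c c' s == B)]|
     <= #|flag A :&: flag B|)%N.
  apply/subset_leq_card/subsetP => s; rewrite inE => /andP[/(jumpP c')[_ _ sA sJ _] /eqP <-].
  by rewrite in_setI sA.
have [nA nA'] := cardF AF; have wA := cardFF AF JF; have wB := cardFF JF AF.
have gM : (l * gap c c' <= M)%N.
  apply: leq_trans lM; rewrite leq_mul2l /gap; apply/orP; right.
  by have := ltn_ord c; have := ltn_ord c'; lia.
apply: leq_trans (leq_mul le (leqnn _)) _.
case: (ltngtP c c') => [lt|lt|/val_inj e]; last by rewrite e eqxx in cc.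
  case: gapJ => /(_ lt)[pr g] _.
  have := card_flag_up (proper_sub pr).
  have : (n ^ (l * gap c c') <= 8 ^ M * M`! * 'C(n - #|A|, #|B| - #|A|))%N.
    apply: leq_expn_bin => //; rewrite /gap.
    - have -> : (c - c' = 0)%N by apply/eqP; rewrite subn_eq0 ltnW.
      by rewrite addn0 leq_subRL // subset_leq_card // proper_sub.
    - by apply: leq_trans w_le; rewrite leq_mul2l leq_subLR wB orbT.
  by move=> le1 le2; apply: leq_trans (leq_mul (leqnn _) le1) _; rewrite mulnCA leq_mul.
case: gapJ => _ /(_ lt)[pr g].
have := card_flag_down (proper_sub pr).
have : (n ^ (l * gap c c') <= 8 ^ M * M`! * 'C(#|A|, #|A| - #|B|))%N.
  apply: leq_expn_bin => //; rewrite /gap.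
  - have -> : (c' - c = 0)%N by apply/eqP; rewrite subn_eq0 ltnW.
    by rewrite add0n leq_subRL // subset_leq_card // proper_sub.
  - by apply: leq_trans w_le; rewrite leq_mul2l leq_subLR wA orbT.
rewrite bin_sub ?(subset_leq_card (proper_sub pr)) //.
by move=> le1 le2; apply: leq_trans (leq_mul (leqnn _) le1) _; rewrite mulnCA leq_mul.
Qed.

(** At least a proportion [d] of the chains through [A] have a window there, and at most [d / 2] are
    not generic for some [C] in [L]. The others are spread over the admissible [B] with small
    fibres, so there are many such [B]. *)
Lemma card_step (A : {set 'I_n}) (c c' : 'I_q) (L : {set {set 'I_n}}) :
  A \in calF -> (A, c) \in G -> c != c' -> L \subset calF ->
  16 * (#|L| * w)%:R <= d * n%:R ->
  d / (2 * (8 ^ M * M`!)%:R) * n%:R ^+ (l * gap c c') <=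
  #|[set B in calF | ((B, c') \in G) && [forall C in L, generic c c' A C B]]|%:R :> K.
Proof.
move=> AF AG cc LF Lw; set m := (l * gap c c')%N; set Y := [set B in calF | _].
pose T := [set s | through set0 chain G A c s].
pose bad := [set s | [exists C in L, through set0 chain G A c s && ~~ generic c c' A C (jump A c c' s)]].
have [nA nA'] := cardF AF.
(* Both [#|A|] and [n - #|A|] are at least [n/4], so each [C] spoils at most a proportion [8w/n]. *)
have lebad : (#|bad| * n <= 8 * (#|L| * w) * #|flag A|)%N.
  pose N := minn #|A| (n - #|A|).
  have nN : (n <= 4 * N)%N by rewrite /N /minn; case: ifP.
  have : (#|bad| * N <= #|L| * ((w + w) * #|flag A|))%N.
    apply: leq_trans (leq_mul (card_exists_le _ _) (leqnn N)) _.
    rewrite big_distrl -sum_nat_const; apply: leq_sum => C CL.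
    by apply: card_not_generic => //; rewrite ?geq_minl ?geq_minr // (subsetP LF).
  move: #|bad| #|L| #|flag A| => a b e; nia.
(* A chain in [T] is either bad or jumps to a member of [Y]. *)
have T_ge : (#|T| * n ^ m <= #|bad| * n ^ m + #|Y| * (8 ^ M * M`! * #|flag A|))%N.
  have le1 : (#|T| <= #|bad| + #|[set s | [exists B in Y, through set0 chain G A c s && (jump A c c' s == B)]]|)%N.
    apply: leq_trans (leq_card_setU _ _); apply/subset_leq_card/subsetP => s; rewrite in_setU !inE => Ts.
    rewrite Ts /=; case: existsP => //= nb; apply/existsP; exists (jump A c c' s); rewrite eqxx andbT.
    have [JF JG _ _ _] := jumpP c' Ts; rewrite inE JF JG /=; apply/forallP => C; apply/implyP => CL.
    by apply/negPn/negP => ng; case: nb; exists C; rewrite CL ng.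
  apply: leq_trans (leq_mul le1 (leqnn _)) _; rewrite mulnDl leq_add2l.
  apply: leq_trans (leq_mul (card_exists_le _ _) (leqnn _)) _.
  rewrite big_distrl -sum_nat_const; apply: leq_sum => B BY.
  exact: card_jump_fiber.
have := G_thr AG; rewrite deg_chain // -/T => dT.
have f0 : 0 < #|flag A|%:R :> K by rewrite ltr0n flag_gt0.
have n0 : 0 < n%:R :> K by rewrite ltr0n.
have nm0 : 0 < n%:R ^+ m :> K by rewrite exprn_gt0.
have k0 : 0 < (8 ^ M * M`!)%:R :> K by rewrite ltr0n muln_gt0 expn_gt0 fact_gt0.
have bad_le : #|bad|%:R <= d / 2 * #|flag A|%:R :> K.
  rewrite -(ler_pM2r n0) -natrM; move: lebad; rewrite -(ler_nat K) => /le_trans; apply.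
  rewrite (natrM _ (8 * _)) (natrM _ 8) -subr_ge0.
  have -> : d / 2 * #|flag A|%:R * n%:R - 8 * (#|L| * w)%:R * #|flag A|%:R
          = #|flag A|%:R * ((d * n%:R - 16 * (#|L| * w)%:R) / 2) :> K by field.
  by rewrite mulr_ge0 ?divr_ge0 ?subr_ge0 // ltW.
have Y_ge : d / 2 * #|flag A|%:R * n%:R ^+ m <= #|Y|%:R * (8 ^ M * M`!)%:R * #|flag A|%:R :> K.
  move: T_ge; rewrite -(ler_nat K) natrD (natrM _ #|T|) (natrM _ #|bad|) (natrM _ #|Y|) natrM natrX.
  rewrite [_ * (_ * #|flag A|%:R)]mulrA => T_ge.
  have {}T_ge : (#|T|%:R - #|bad|%:R) * n%:R ^+ m
      <= #|Y|%:R * (8 ^ M * M`!)%:R * #|flag A|%:R :> K by rewrite mulrBl lerBlDl.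
  apply: le_trans T_ge; rewrite ler_pM2r //; lra.
rewrite -(ler_pM2r k0) -(ler_pM2r f0); apply: le_trans Y_ge.
rewrite le_eqVlt; apply/orP; left; apply/eqP; move: k0; move: (8 ^ M * M`!)%:R => k k0.
by field; rewrite lt0r_neq0.
Qed.
End Step.
End Chain.

(** * Leaves of tree posets *)

Section Covers.
Variables (T : finType) (lt : rel T).
Hypotheses (lt_irr : irreflexive lt) (lt_trans : transitive lt).

Lemma covers_lt x y : covers lt x y -> lt x y.
Proof. by case/andP. Qed.

Lemma covers_flip x y : covers (fun a b => lt b a) x y = covers lt y x.
Proof. by rewrite /covers; congr (_ && _); apply: eq_forallb => z; rewrite andbC. Qed.

(** Induction on the number of elements strictly between [z] and [y]: if [y] does not cover [z],
    move [z] up to an intermediate element. *)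
Lemma covers_last z y : lt z y -> exists2 w, covers lt w y & (z == w) || lt z w.
Proof.
have [m] := ubnP #|[set u | lt z u && lt u y]|; elim: m z => // m IH z ltm zy.
have [zy'|] := boolP (covers lt z y); first by exists z; rewrite ?eqxx.
rewrite /covers zy /= negb_forall => /existsP[u]; rewrite negbK => /andP[zu uy].
have [|//|w wy uw] := IH u; last first.
  exists w => //; case/orP: uw => [/eqP <-|uw]; first by rewrite zu orbT.
  by rewrite (lt_trans zu uw) orbT.
rewrite -ltnS; apply: leq_trans ltm; rewrite ltnS; apply: proper_card; apply/properP; split.
  by apply/subsetP => a; rewrite !inE => /andP[ua ->]; rewrite (lt_trans zu ua).
by exists u; rewrite !inE ?zu ?uy // lt_irr.
Qed.

(** Follows a saturated chain from [z] to [w]. The relation [e] need only contain the covers within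
    that interval, so it may omit an edge elsewhere. *)
Lemma connect_lt (e : rel T) z w : lt z w ->
  (forall a b, covers lt a b -> (z == a) || lt z a -> (b == w) || lt b w -> e a b) ->
  connect e z w.
Proof.
have [m] := ubnP #|[set u | lt z u && lt u w]|; elim: m w => // m IH w ltm zw He.
have [w' ww zw'] := covers_last zw; have lw := covers_lt ww.
apply: (@connect_trans _ _ w'); last by apply/connect1/He; rewrite ?eqxx.
case/orP: zw' => [/eqP -> //|zw']; apply: IH => // [|a b ab za bw]; last first.
  apply: He => //; case/orP: bw => [/eqP ->|bw]; first by rewrite lw orbT.
  by rewrite (lt_trans bw lw) orbT.
rewrite -ltnS; apply: leq_trans ltm; rewrite ltnS; apply: proper_card; apply/properP; split.
  by apply/subsetP => a; rewrite !inE => /andP[-> aw]; rewrite (lt_trans aw lw).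
by exists w'; rewrite !inE ?zw' ?lw // lt_irr andbF.
Qed.

End Covers.

Lemma covers_first (T : finType) (lt : rel T) y z :
  irreflexive lt -> transitive lt -> lt y z -> exists2 w, covers lt y w & (w == z) || lt w z.
Proof.
move=> irr tr yz.
have [|//|w] := @covers_last T (fun a b => lt b a) irr _ z y; first by move=> a b c ba ac; apply: tr ac ba.
by rewrite covers_flip eq_sym; exists w.
Qed.

(** * Bridges and leaves in an acyclic graph *)

Section Bridge.
Variables (T : finType) (adj : rel T).
Hypotheses (adj_irr : irreflexive adj) (adj_sym : symmetric adj).
Hypothesis acyclic : forall s : seq T, 3 <= size s -> uniq s -> ~~ path.cycle adj s.

Definition del_edge (x y : T) : rel T :=
  [rel a b | adj a b && ~~ ((a == x) && (b == y) || (a == y) && (b == x))].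

Lemma del_edge_sym x y : symmetric (del_edge x y).
Proof. by move=> a b; rewrite /del_edge /= adj_sym orbC ![(b == _) && _]andbC. Qed.

(** A simple path from [x] to [y] avoiding this edge has at least three vertices, and the edge
    closes it into a cycle. *)
Lemma bridge x y : adj x y -> ~~ connect (del_edge x y) x y.
Proof.
move=> xy; apply/negP => /connectP[p Hp ey]; move: ey xy.
case/shortenP: Hp => -[|z [|z' p']] Hp u _ ey; subst y; first by rewrite /= adj_irr.
  by move: Hp; rewrite /del_edge /= !eqxx /= andbF.
move=> xy; have := acyclic _ u => /(_ isT)/negP; apply.
rewrite /path.cycle rcons_path adj_sym xy andbT.
by apply: sub_path Hp => a b /andP[].
Qed.

Definition inner (S : {set T}) : rel T := [rel a b | [&& adj a b, a \in S & b \in S]].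

Definition connected_set (S : {set T}) := forall a b, a \in S -> b \in S -> connect (inner S) a b.

Lemma connected_setU1 (S : {set T}) x y : connected_set S -> x \in S -> adj x y ->
  connected_set (y |: S).
Proof.
move=> cS xS xy.
have sym : connect_sym (inner (y |: S)).
  by apply: sym_connect_sym => a b; rewrite /inner /= adj_sym; congr (_ && _); rewrite andbC.
have toS a : a \in S -> connect (inner (y |: S)) x a.
  move=> aS; apply: connect_sub (cS _ _ xS aS) => b c /and3P[bc bS cS'].
  by apply: connect1; rewrite /inner /= bc !inE bS cS' !orbT.
have toy a : a \in y |: S -> connect (inner (y |: S)) x a.
  rewrite !inE => /orP[/eqP ->|/toS //]; apply: connect1.
  by rewrite /inner /= xy !inE xS eqxx orbT.
by move=> a b /toy ax /toy xb; apply: connect_trans xb; rewrite sym.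
Qed.

Lemma connect_del_edge (S : {set T}) x y z : connected_set S -> x \in S -> z \in S -> y \notin S ->
  connect (del_edge x y) x z.
Proof.
move=> cS xS zS yS; apply: connect_sub (cS _ _ xS zS) => a b /and3P[ab aS bS].
apply: connect1; rewrite /del_edge /= ab /=; apply/norP; split; apply/negP => /andP[/eqP e1 /eqP e2]; subst.
  by rewrite bS in yS.
by rewrite aS in yS.
Qed.

(** Otherwise [x] and [y] would be joined without their edge, against [bridge]: go from [x] to [z]
    inside [S], then along a saturated chain between [z] and [y]. If [z] is above [y], the rest of
    that chain stays above [y] and misses [x]; if [z] is below [y], choose a chain that enters [y]
    from a lower cover other than [x]. *)
Lemma leaf_above (lt : rel T) (S : {set T}) x y z :
  irreflexive lt -> transitive lt -> (forall a b, covers lt a b -> adj a b) ->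
  connected_set S -> x \in S -> z \in S -> y \notin S -> covers lt x y ->
  lt z y = (z == x) || lt z x /\ ~~ lt y z.
Proof.
move=> irr tr adjP cS xS zS yS xy.
have lxy := covers_lt xy; have br := bridge (adjP _ _ xy).
have xz := connect_del_edge cS xS zS yS.
have sym : connect_sym (del_edge x y) by apply/sym_connect_sym/del_edge_sym.
split; last first.
  apply/negP => yz; case/negP: br; apply: connect_trans xz _; rewrite sym.
  have [w yw wz] := covers_first irr tr yz; have lyw := covers_lt yw.
  apply: (@connect_trans _ _ w).
    apply: connect1; rewrite /del_edge /= (adjP _ _ yw) eqxx /=.
    apply/negP => /orP[/andP[_ /eqP e]|/eqP e]; subst w; first by rewrite irr in lyw.
    by have := tr _ _ _ lxy lyw; rewrite irr.
  case/orP: wz => [/eqP -> //|wz]; apply: (connect_lt irr tr wz) => a b ab wa _.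
  have ya : lt y a by case/orP: wa => [/eqP <- //|]; apply: tr.
  have yb := tr _ _ _ ya (covers_lt ab).
  rewrite /del_edge /= (adjP _ _ ab) /=; apply/norP; split; apply/negP => /andP[/eqP e1 /eqP e2]; subst.
    by rewrite irr in yb.
  by rewrite irr in ya.
apply/idP/idP => [zy|/orP[/eqP -> //|zx]]; last exact: tr zx lxy.
have [w wy zw] := covers_last irr tr zy; have [<-|wx] := eqVneq w x; first exact: zw.
have lwy := covers_lt wy; case/negP: br; apply: connect_trans xz _.
apply: (@connect_trans _ _ w); last first.
  apply: connect1; rewrite /del_edge /= (adjP _ _ wy) (negPf wx) /=.
  by apply/negP => /andP[/eqP e _]; rewrite e irr in lwy.
case/orP: zw => [/eqP -> //|zw]; apply: (connect_lt irr tr zw) => a b ab _ bw.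
have yb : lt b y by case/orP: bw => [/eqP -> //|bw]; apply: tr bw lwy.
have ya := tr _ _ _ (covers_lt ab) yb.
rewrite /del_edge /= (adjP _ _ ab) /=; apply/norP; split; apply/negP => /andP[/eqP e1 /eqP e2]; subst.
  by rewrite irr in yb.
by rewrite irr in ya.
Qed.

Lemma leaf_below (lt : rel T) (S : {set T}) x y z :
  irreflexive lt -> transitive lt -> (forall a b, covers lt a b -> adj a b) ->
  connected_set S -> x \in S -> z \in S -> y \notin S -> covers lt y x ->
  lt y z = (z == x) || lt x z /\ ~~ lt z y.
Proof.
move=> irr tr adjP cS xS zS yS yx.
apply: (@leaf_above (fun a b => lt b a) S) => //.
- by move=> a b c ba ac; apply: tr ac ba.
- by move=> a b; rewrite covers_flip adj_sym => /adjP.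
- by rewrite covers_flip.
Qed.

(** A path from [v] to a vertex outside [S] has a first step that leaves [S]. *)
Lemma exists_leaf (S : {set T}) v : (forall a b, connect adj a b) -> v \in S -> S != setT ->
  exists x y, [/\ x \in S, y \notin S & adj x y].
Proof.
move=> conn vS ST; have [u uS] : exists u, u \notin S.
  by apply/existsP; rewrite -negb_forall; apply: contraNN ST => /forallP H; apply/eqP/setP => u; rewrite H inE.
have /connectP[p Hp eu] := conn v u.
elim: p v vS Hp eu => [|a p IH] v vS /=; first by move=> _ e; rewrite e vS in uS.
move=> /andP[va Hp] eu; have [aS|aS] := boolP (a \in S); first exact: IH aS Hp eu.
by exists v, a.
Qed.
End Bridge.

Local Open Scope ring_scope.

(** * Embedding a tree poset leaf by leaf *)

Section Embedding.
Variables (n l q : nat) (T : finType) (lt : rel T) (v : T) (c : T -> 'I_q).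
Variables (calF : {set {set 'I_n}}) (Gam : {set {set {set 'I_n}}}).
Variables (G : {set {set 'I_n} * 'I_q}) (F0 : {set 'I_n}) (g : R).
Hypotheses (lt_irr : irreflexive lt) (lt_trans : transitive lt) (tree : is_tree_poset lt).
Hypothesis c_mono : forall x y, lt x y -> (c x < c y)%N.
Hypotheses (g_gt0 : 0 < g) (n_gt0 : (0 < n)%N).
Hypothesis Gam_bounded : gl_bounded (g / 2) l calF Gam.
Hypothesis step : forall (A : {set 'I_n}) (i j : 'I_q) (L : {set {set 'I_n}}),
  A \in calF -> (A, i) \in G -> i != j -> L \subset calF -> (#|L| <= #|T|)%N ->
  g * n%:R ^+ (l * gap i j) <=
  #|[set B in calF | ((B, j) \in G) && [forall C in L, generic i j A C B]]|%:R :> R.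
Hypotheses (F0F : F0 \in calF) (F0G : (F0, c v) \in G).

Local Notation adj := (hasse_adj lt).

Lemma adj_sym : symmetric adj.
Proof. by move=> a b; rewrite /hasse_adj orbC. Qed.

Lemma adj_irr : irreflexive adj.
Proof. by move=> a; rewrite /hasse_adj /covers lt_irr. Qed.

Lemma covers_adj a b : covers lt a b -> adj a b.
Proof. by rewrite /hasse_adj => ->. Qed.

Implicit Types (S : {set T}) (phi : {ffun T -> {set 'I_n}}).

(* Maps defined on [S] only, encoded by the value [set0] outside [S]. *)
Definition partial_emb S : {set {ffun T -> {set 'I_n}}} :=
  [set phi : {ffun T -> {set 'I_n}} | [&& [forall z, (z \notin S) ==> (phi z == set0)],
    [forall z in S, (phi z \in calF) && ((phi z, c z) \in G)],
    [forall a in S, forall b in S, (phi a \subset phi b) == ((a == b) || lt a b)],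
    phi @: S \notin Gam & phi v == F0]].

Lemma partial_embP S phi : reflect
  [/\ forall z, z \notin S -> phi z = set0,
      forall z, z \in S -> phi z \in calF /\ (phi z, c z) \in G,
      forall a b, a \in S -> b \in S -> (phi a \subset phi b) = (a == b) || lt a b,
      phi @: S \notin Gam & phi v = F0]
  (phi \in partial_emb S).
Proof.
rewrite inE; apply: (iffP and5P) => -[H1 H2 H3 H4 H5]; split => //.
- by move=> z zS; apply/eqP; move/forallP/(_ z)/implyP: H1; apply.
- by move=> z zS; apply/andP; move/forallP/(_ z)/implyP: H2; apply.
- move=> a b aS bS; apply/eqP; move/forallP/(_ a)/implyP/(_ aS)/forallP/(_ b)/implyP: H3; exact.
- exact/eqP.
- by apply/forallP => z; apply/implyP => /H1 ->.
- by apply/forallP => z; apply/implyP => /H2 [-> ->].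
- by apply/forallP => a; apply/implyP => aS; apply/forallP => b; apply/implyP => bS; rewrite H3.
- by rewrite H5.
Qed.

Definition choices S x y phi : {set {set 'I_n}} :=
  [set B in calF | [&& (B, c y) \in G,
    [forall C in phi @: S, generic (c x) (c y) (phi x) C B] & (B |: phi @: S) \notin Gam]].

Definition extend phi y B : {ffun T -> {set 'I_n}} := [ffun z => if z == y then B else phi z].

Lemma img_extend S phi y B : y \notin S -> extend phi y B @: (y |: S) = B |: phi @: S.
Proof.
move=> yS; rewrite imsetU1 ffunE eqxx; congr (_ |: _); apply: eq_in_imset => z zS.
by rewrite ffunE; case: eqP => // e; rewrite e (negPf yS) in zS.
Qed.

(** Genericity leaves [B] only the comparabilities forced through [phi x]; in a tree the new leaf
    [y] is likewise comparable to [S] only through [x]. The two patterns agree. *)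
Lemma extend_mem S x y phi B : connected_set adj S -> v \in S -> x \in S -> y \notin S -> adj x y ->
  phi \in partial_emb S -> B \in choices S x y phi -> extend phi y B \in partial_emb (y |: S).
Proof.
move=> cS vS xS yS xy /partial_embP[H1 H2 H3 H4 H5].
rewrite inE => /and4P[BF BG /forallP gen BGam].
have {}gen C : C \in phi @: S -> generic (c x) (c y) (phi x) C B by apply/implyP.
have yz z : z \in S -> (z == y) = false by move=> zS; apply: contraNF yS => /eqP <-.
have key z : z \in S -> (phi z \subset B) = lt z y /\ (B \subset phi z) = lt y z.
  move=> zS; have := gen _ (imset_f phi zS); rewrite /generic; case/orP: xy => xy.
    rewrite (c_mono (covers_lt xy)) => /andP[pr /andP[nB Bz]].
    have [-> /negPf ->] := leaf_above adj_irr adj_sym tree.2 lt_irr lt_trans covers_adj cS xS zS yS xy.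
    rewrite (negPf nB) -H3 //; split => //; apply/idP/idP; first exact/implyP.
    by move=> /subset_trans; apply; apply: proper_sub.
  rewrite ltnNge (ltnW (c_mono (covers_lt xy))) /= => /andP[pr /andP[nB Bz]].
  have [-> /negPf ->] := leaf_below adj_irr adj_sym tree.2 lt_irr lt_trans covers_adj cS xS zS yS xy.
  rewrite (negPf nB) eq_sym -H3 //; split => //; apply/idP/idP; first exact/implyP.
  by apply: subset_trans; apply: proper_sub.
apply/partial_embP; split.
- by move=> z; rewrite in_setU1 negb_or ffunE => /andP[/negPf -> /H1].
- move=> z; rewrite in_setU1 ffunE => /orP[/eqP ->|zS]; first by rewrite eqxx.
  by rewrite yz //; apply: H2.
- move=> a b; rewrite !in_setU1 !ffunE => /orP[/eqP ->|aS] /orP[/eqP ->|bS]; rewrite ?eqxx ?subxx //.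
  + by rewrite yz // eq_sym yz //=; case: (key b bS).
  + by rewrite yz //=; case: (key a aS).
  + by rewrite !yz // H3.
- by rewrite img_extend.
- by rewrite ffunE yz.
Qed.

(** An extension determines its pair: [B] is its value at [y], and [phi] is the rest, being [set0]
    at [y]. *)
Lemma card_extend S x y : connected_set adj S -> v \in S -> x \in S -> y \notin S -> adj x y ->
  (\sum_(phi in partial_emb S) #|choices S x y phi| <= #|partial_emb (y |: S)|)%N.
Proof.
move=> cS vS xS yS xy; under eq_bigr do rewrite -sum1_card.
rewrite pair_big_dep /= sum1dep_card.
rewrite -(card_in_imset (f := fun p : {ffun T -> {set 'I_n}} * {set 'I_n} => extend p.1 y p.2)).
  apply/subset_leq_card/subsetP => e /imsetP[[phi B]]; rewrite inE /= => /andP[pS pB] ->.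
  exact: extend_mem pB.
move=> [phi B] [phi' B']; rewrite [in X in X -> _]inE [in X in _ -> X -> _]inE /= => /andP[pS _] /andP[pS' _] e.
have eB : B = B' by move/ffunP/(_ y): e; rewrite !ffunE eqxx.
rewrite eB; congr (_, _); apply/ffunP => z.
have [->|zy] := eqVneq z y; last by move/ffunP/(_ z): e; rewrite !ffunE (negPf zy).
by case/partial_embP: pS => e1 _ _ _ _; case/partial_embP: pS' => e2 _ _ _ _; rewrite e1 ?e2.
Qed.

(** Among the [g * n ^ (l * gap)] generic candidates, boundedness applied to the image of [phi]
    excludes fewer than [g / 2 * n ^ l], at most half of them. *)
Lemma card_choices S x y phi : x \in S -> y \notin S -> adj x y -> phi \in partial_emb S ->
  g / 2 * n%:R ^+ (l * gap (c x) (c y)) <= #|choices S x y phi|%:R.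
Proof.
move=> xS yS xy /partial_embP[_ H2 _ H4 _].
have cxy : c x != c y.
  by case/orP: xy => /covers_lt/c_mono; rewrite ltn_neqAle => /andP[+ _]; apply: contraNneq => ->.
have sF : phi @: S \subset calF by apply/subsetP => _ /imsetP[z zS ->]; case: (H2 z zS).
have [AF AG] := H2 x xS.
have Lc : (#|phi @: S| <= #|T|)%N by apply: leq_trans (leq_imset_card _ _) (max_card _).
have := step AF AG cxy sF Lc; set Y := [set B in calF | _].
have [_ _ /(_ _ sF H4)] := Gam_bounded; set Z := [set B in calF | _].
have YZ : (#|Y| <= #|choices S x y phi| + #|Z|)%N.
  apply: leq_trans (leq_card_setU _ _); apply/subset_leq_card/subsetP => B.
  rewrite !inE => /and3P[-> -> ->] /=; by case: (_ \in Gam).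
move: YZ; rewrite -(ler_nat R) natrD => YZ ltZ geY.
(* Adjacent elements receive different positions, so [n ^ l <= n ^ (l * gap)]. *)
have g1 : (1 <= gap (c x) (c y))%N.
  by move: cxy; rewrite /gap -val_eqE neq_ltn => /orP[] h; rewrite addn_gt0 !subn_gt0 h ?orbT.
have le_pow : g / 2 * n%:R ^+ l <= g / 2 * n%:R ^+ (l * gap (c x) (c y)) :> R.
  rewrite ler_pM2l ?divr_gt0 // ler_weXn2l ?ler1n //.
  by rewrite -[leqLHS]muln1 leq_mul2l g1 orbT.
have {}le_pow := lt_le_trans ltZ le_pow.
rewrite -(lerD2r #|Z|%:R); apply: le_trans YZ; apply: le_trans geY.
apply: le_trans (lerD (lexx _) (ltW le_pow)) _.
by rewrite -mulrDl -splitr.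
Qed.

Definition edge_wt (e : T * T) : R := n%:R ^+ (l * gap (c e.1) (c e.2)).
Definition edge_in S (e : T * T) := [&& covers lt e.1 e.2, e.1 \in S & e.2 \in S].

(** Adding [y] creates a single Hasse edge: an element of [S] below [y] is at most [x], so it can
    only be covered by [y] if it equals [x], and dually. *)
Lemma prod_edges S x y : connected_set adj S -> x \in S -> y \notin S -> adj x y ->
  \prod_(e | edge_in (y |: S) e) edge_wt e
    = n%:R ^+ (l * gap (c x) (c y)) * \prod_(e | edge_in S e) edge_wt e.
Proof.
move=> cS xS yS xy.
have [e0 [He0 wt0 only]] : exists e0, [/\ edge_in (y |: S) e0 && ~~ edge_in S e0,
    edge_wt e0 = n%:R ^+ (l * gap (c x) (c y)) &
    forall e, edge_in (y |: S) e -> e != e0 -> edge_in S e].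
  case/orP: xy => xy.
    exists (x, y); split => //; first by rewrite /edge_in /= xy !inE xS eqxx orbT (negPf yS) andbF.
    move=> [a b]; rewrite /edge_in /= !in_setU1 xpair_eqE => /and3P[ab /orP[/eqP ea|aS] /orP[/eqP eb|bS]] ne.
    - by move: (covers_lt ab); rewrite ea eb lt_irr.
    - have [_] := leaf_above adj_irr adj_sym tree.2 lt_irr lt_trans covers_adj cS xS bS yS xy.
      by rewrite -ea (covers_lt ab).
    - have [] := leaf_above adj_irr adj_sym tree.2 lt_irr lt_trans covers_adj cS xS aS yS xy.
      subst b; rewrite (covers_lt ab); move: ne; rewrite eqxx andbT => /negPf -> /= /esym ax _.
      by move: ab => /andP[_ /forallP/(_ x)]; rewrite ax (covers_lt xy).
    - by rewrite ab aS bS.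
  exists (y, x); split => //; first by rewrite /edge_in /= xy !inE xS eqxx orbT (negPf yS).
    by rewrite /edge_wt /gap /= addnC.
  move=> [a b]; rewrite /edge_in /= !in_setU1 xpair_eqE => /and3P[ab /orP[/eqP ea|aS] /orP[/eqP eb|bS]] ne.
  - by move: (covers_lt ab); rewrite ea eb lt_irr.
  - have [] := leaf_below adj_irr adj_sym tree.2 lt_irr lt_trans covers_adj cS xS bS yS xy.
    subst a; rewrite (covers_lt ab); move: ne; rewrite eqxx /= => /negPf -> /= /esym xb _.
    by move: ab => /andP[_ /forallP/(_ x)]; rewrite xb (covers_lt xy).
  - have [_] := leaf_below adj_irr adj_sym tree.2 lt_irr lt_trans covers_adj cS xS aS yS xy.
    by rewrite -eb (covers_lt ab).
  - by rewrite ab aS bS.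
case/andP: He0 => He0 nHe0.
rewrite (bigD1 e0) //= wt0; congr (_ * _); apply: eq_bigl => e.
apply/andP/idP => [[He ne]|He]; first exact: only He ne.
split; last by apply: contraNneq nHe0 => <-.
by move: He; rewrite /edge_in => /and3P[-> eS eS']; rewrite !inE eS eS' !orbT.
Qed.

Definition enough S := (g / 2) ^+ (#|S| - 1) * \prod_(e | edge_in S e) edge_wt e
  <= #|partial_emb S|%:R.

Lemma enough1 : enough [set v].
Proof.
rewrite /enough cards1 subnn expr0 mul1r big1 ?ler1n.
  rewrite card_gt0; apply/set0Pn; exists [ffun z => if z == v then F0 else set0].
  apply/partial_embP; split.
  - by move=> z; rewrite inE ffunE => /negPf ->.
  - by move=> z; rewrite inE ffunE => /eqP ->; rewrite eqxx.
  - by move=> a b; rewrite !inE !ffunE => /eqP -> /eqP ->; rewrite eqxx subxx.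
  - by rewrite imset_set1 ffunE eqxx; case: Gam_bounded => _ /(_ _ F0F).
  - by rewrite ffunE eqxx.
move=> [a b]; rewrite /edge_in !inE /= => /and3P[ab /eqP ea /eqP eb].
by move: (covers_lt ab); rewrite ea eb lt_irr.
Qed.

Lemma enoughU1 S x y : connected_set adj S -> v \in S -> x \in S -> y \notin S -> adj x y ->
  enough S -> enough (y |: S).
Proof.
move=> cS vS xS yS xy; rewrite /enough => IH.
have := card_extend cS vS xS yS xy; rewrite -(ler_nat R); apply: le_trans.
rewrite (prod_edges cS xS yS xy) cardsU1 yS natr_sum /=.
have S1 : (0 < #|S|)%N by rewrite card_gt0; apply/set0Pn; exists v.
rewrite add1n subn1 /= -{1}(prednK S1) -subn1 exprS.
have -> (a b d e : R) : a * b * (d * e) = (b * e) * (a * d) by ring.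
apply: (@le_trans _ _ (#|partial_emb S|%:R * (g / 2 * n%:R ^+ (l * gap (c x) (c y))))).
  by rewrite ler_wpM2r // mulr_ge0 ?exprn_ge0 ?ler0n // divr_ge0 // ltW.
rewrite mulr_natl -sumr_const; apply: ler_sum => phi pS.
exact: card_choices.
Qed.

(** Grow [S] from [[set v]] by one adjacent vertex at a time; [S] stays connected, so each new
    vertex is a leaf. *)
Lemma enoughT : enough setT.
Proof.
have H S : v \in S -> connected_set adj S -> enough S -> enough setT.
  have [m] := ubnP #|~: S|; elim: m S => // m IH S ltm vS cS eS.
  have [<- //|ST] := eqVneq S setT.
  have [x [y [xS yS xy]]] := exists_leaf tree.1 vS ST.
  apply: (IH (y |: S)); last exact: enoughU1 xy eS.
  - rewrite -ltnS; apply: leq_trans ltm; rewrite ltnS setCU; apply: proper_card.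
    apply/properP; split; first exact: subsetIr.
    by exists y; rewrite !inE ?yS ?eqxx ?(negPf yS).
  - by rewrite !inE vS orbT.
  - exact: (connected_setU1 adj_sym cS xS xy).
apply: (H [set v]) enough1; first by rewrite set11.
by move=> a b; rewrite !inE => /eqP -> /eqP ->.
Qed.

Lemma embedding_count :
  (g / 2) ^+ (#|T| - 1) * \prod_(e : T * T | covers lt e.1 e.2) edge_wt e
   <= #|[set phi : {ffun T -> {set 'I_n}} |
          [&& ind_inj_hom lt calF phi, img phi \notin Gam & phi v == F0]]|%:R.
Proof.
have := enoughT; rewrite /enough cardsT.
rewrite (eq_bigl (fun e => covers lt e.1 e.2)) => [|e]; last by rewrite /edge_in !inE !andbT.
move=> /le_trans; apply; rewrite ler_nat; apply/subset_leq_card/subsetP => phi.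
move=> /partial_embP[_ H2 H3 H4 H5]; rewrite inE H5 eqxx andbT /ind_inj_hom.
have anti a b : lt a b -> lt b a = false by move=> ab; apply/negP => /(lt_trans ab); rewrite lt_irr.
(* Equal images are contained in each other, and antisymmetry of the order leaves only equality. *)
have inj : injective phi.
  move=> a b ab; have := H3 a b; have := H3 b a; rewrite ab subxx !inE => /(_ isT isT)/esym h1 /(_ isT isT)/esym.
  case/orP=> [/eqP //|lab]; move: h1; rewrite (anti _ _ lab) orbF => /eqP //.
apply/andP; split; last first.
  rewrite (_ : img phi = phi @: setT) //.
  by apply/setP => B; apply/imsetP/imsetP => -[z _ ->]; exists z; rewrite ?inE.
apply/and3P; split; first exact/injectiveP.
  by apply/forallP => z; case: (H2 z).
apply/forallP => a; apply/forallP => b; rewrite properE !H3 ?inE //.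
have [->|ab] := eqVneq a b; first by rewrite lt_irr eqxx.
by rewrite /=; case: (boolP (lt a b)) => // /anti ->.
Qed.

End Embedding.

(** * Sizes of the members of the middle layers *)

Section Asymptotics.
Local Open Scope R_scope.

Lemma ln_le_sqrt x : 0 < x -> ln x <= 2 * sqrt x.
Proof.
move=> x0; have s0 := sqrt_lt_R0 x x0.
have e : ln x = ln (sqrt x) + ln (sqrt x) by rewrite -ln_mult // sqrt_sqrt //; apply: Rlt_le.
have le := exp_ineq1_le (ln (sqrt x)); rewrite exp_ln // in le.
by rewrite e; Lra.lra.
Qed.

Lemma sqrt_mul_ln_le (e : R) : 0 < e ->
  exists N : nat, forall n : nat, (N <= n)%N -> 2 * sqrt (INR n * ln (INR n)) <= e * INR n.
Proof.
(* For [n >= a ^ 2] one has [e ^ 2 * sqrt n >= 8], hence [n * ln n <= 2 * n * sqrt n <= (e * n / 2)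
   ^ 2]. *)
move=> e0; pose a := 8 / (e * e).
have ee : 0 < e * e by apply: Rmult_lt_0_compat.
have a0 : 0 < a by apply: Rdiv_lt_0_compat => //; Lra.lra.
have [N HN] := INR_unbounded (a * a); exists N => n /ssrnat.leP Nn.
have nN := le_INR _ _ Nn.
have n0 : 0 < INR n by have := Rmult_lt_0_compat _ _ a0 a0; Lra.lra.
have s0 := sqrt_lt_R0 _ n0.
have ss : sqrt (INR n) * sqrt (INR n) = INR n by apply: sqrt_sqrt; Lra.lra.
have as' : a <= sqrt (INR n).
  rewrite -(sqrt_square a); last by Lra.lra.
  by apply: sqrt_le_1_alt; Lra.lra.
have es : 8 <= e * e * sqrt (INR n).
  have -> : 8 = e * e * a.
    by rewrite /a /Rdiv (Rmult_comm 8) -Rmult_assoc Rinv_r ?Rmult_1_l //; apply: Rgt_not_eq.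
  by apply: Rmult_le_compat_l; Lra.lra.
have en : 0 <= e * INR n / 2 by have := Rmult_lt_0_compat _ _ e0 n0; Lra.lra.
have : sqrt (INR n * ln (INR n)) <= e * INR n / 2; last by Lra.lra.
rewrite -[X in _ <= X](sqrt_square _ en); apply: sqrt_le_1_alt.
have l1 := ln_le_sqrt n0.
have l2 : INR n * ln (INR n) <= INR n * (2 * sqrt (INR n)) by apply: Rmult_le_compat_l; Lra.lra.
have l3 : INR n * sqrt (INR n) * 8 <= INR n * sqrt (INR n) * (e * e * sqrt (INR n)).
  by apply: Rmult_le_compat_l => //; have := Rmult_lt_0_compat _ _ n0 s0; Lra.lra.
have l4 : INR n * sqrt (INR n) * (e * e * sqrt (INR n)) = 4 * (e * INR n / 2 * (e * INR n / 2)).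
  have := f_equal (Rmult (e * e * INR n)) ss; cbv beta; Lra.lra.
Lra.lra.
Qed.

End Asymptotics.

Lemma Btilde_narrow (d : R) (t : nat) : 0 < d ->
  exists N : nat, forall n : nat, (N <= n)%N -> (0 < n)%N /\ exists w : nat,
    [/\ (8 * w <= n)%N, 16 * (t * w)%:R <= d * n%:R,
        forall A, A \in Btilde n -> (n <= 4 * #|A| /\ n <= 4 * (n - #|A|))%N &
        forall A B, A \in Btilde n -> B \in Btilde n -> (#|A| <= #|B| + w)%N].
Proof.
move=> d0.
(* Sizes will lie within [e * n] of [n / 2], and [w] is about [2 * e * n]. The bound [16 * e <= 1]
   gives [8 * w <= n] and sizes at least [n/4] from both ends; [32 * t * e <= d] gives the bound on
   [t * w]. *)
have [e [e0 e16 et]] : exists e : R, [/\ 0 < e, 16 * e <= 1 & 32 * t%:R * e <= d].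
  have t0 := ler0n R t; have D0 : 0 < 32 * t%:R + 16 * d + 16 :> R by lra.
  exists (d / (32 * t%:R + 16 * d + 16)); split; first by rewrite divr_gt0.
    by rewrite mulrA ler_pdivrMr // mul1r; lra.
  by rewrite mulrA ler_pdivrMr // mulrC ler_pM2l //; lra.
have [N HN] := sqrt_mul_ln_le (elimT RltP e0).
exists N.+1 => n Nn; have n_gt0 : (0 < n)%N by apply: leq_trans Nn.
have n0 : 0 < n%:R :> R by rewrite ltr0n.
split=> //; exists (Num.truncn (2 * e * n%:R)).
have trunc_le : (Num.truncn (2 * e * n%:R))%:R <= 2 * e * n%:R.
  by rewrite truncn_le // !mulr_ge0 ?ler0n // ltW.
have near A : A \in Btilde n -> `|#|A|%:R - n%:R / 2| < e * n%:R :> R.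
  rewrite inE => /lt_le_trans; apply.
  by have /RleP := HN n (ltnW Nn); rewrite !INRE.
split.
- rewrite -(ler_nat R) natrM; nra.
- rewrite natrM; have := ler0n R t; nra.
- move=> A /near; rewrite ltr_norml => /andP[lo hi]; split.
    rewrite -(ler_nat R) natrM; nra.
  have An : (#|A| <= n)%N by apply: cardsn.
  rewrite -(ler_nat R) natrM natrB //; nra.
- move=> A B /near; rewrite ltr_norml => /andP[loA hiA] /near; rewrite ltr_norml => /andP[loB hiB].
  rewrite -leq_subLR truncn_ge_nat; last by rewrite !mulr_ge0 ?ler0n // ltW.
  have [AB|AB] := leqP #|A| #|B|.
    by move: (AB); rewrite -subn_eq0 => /eqP ->; rewrite !mulr_ge0 ?ler0n // ltW.
  rewrite natrB ?(ltnW AB) //; nra.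
Qed.

(** * Average number of members on a chain, and assembly *)

Lemma lubell_le n (calF : {set {set 'I_n}}) :
  lubell calF * (n`!)%:R <= (\sum_s size (chain calF s))%:R.
Proof.
rewrite -sum_deg; last exact: chain_uniq.
rewrite (bigID (mem calF)) /= [X in (_ + X)%N]big1 ?addn0; last by move=> A /deg_chain0.
rewrite natr_sum /lubell mulr_suml; apply: ler_sum => A AF.
rewrite (deg_chain AF) mulrC ler_pdivrMr ?ltr0n ?bin_gt0 ?cardsn //.
by rewrite -natrM ler_nat card_flag_ge.
Qed.

(** With [b = eps / (q - 1 + eps)] the choice of [d] makes [d * q = b / 2], and [(1 - b / 2) * (q -
    1 + eps) = q - 1 + eps / 2] exceeds [q - 1]. *)
Lemma exists_proportion (K : realFieldType) (q : nat) (eps : K) : (0 < q)%N -> 0 < eps ->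
  exists2 d : K, 0 < d & forall S f, 0 < f -> (q%:R - 1 + eps) * f <= S ->
    d * q%:R * S < S - (q%:R - 1) * f.
Proof.
move=> q_gt0 eps0; have q1 : 1 <= q%:R :> K by rewrite ler1n.
have q0 : 0 < q%:R :> K by rewrite ltr0n.
have a0 : 0 < q%:R - 1 + eps by lra.
exists (eps / (2 * q%:R * (q%:R - 1 + eps))); first by rewrite divr_gt0 // !mulr_gt0.
move=> S f f0 S_ge.
have -> : eps / (2 * q%:R * (q%:R - 1 + eps)) * q%:R = eps / (q%:R - 1 + eps) / 2.
  by field; rewrite !lt0r_neq0.
have ea : eps / (q%:R - 1 + eps) * (q%:R - 1 + eps) = eps by rewrite divfK // lt0r_neq0.
have : eps / (q%:R - 1 + eps) <= 1 by rewrite ler_pdivrMr // mul1r; lra.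
move: (eps / (q%:R - 1 + eps)) ea => b ea b1.
have H1 : 0 <= (1 - b / 2) * (S - (q%:R - 1 + eps) * f) by rewrite mulr_ge0 ?subr_ge0 //; lra.
have H2 : b * (q%:R - 1 + eps) * f = eps * f by rewrite ea.
have H3 : 0 < eps * f by rewrite mulr_gt0.
lra.
Qed.

Theorem theorem5p2 (q l : nat) (eps : R) :
  (0 < q)%N -> (0 < l)%N -> 0 < eps ->
  exists gam : R, 0 < gam /\
  forall (T : finType) (lt : rel T) (k : nat),
    strict_porder lt -> is_tree_poset lt -> height lt = k -> (k <= q)%N ->
    exists N : nat, forall n : nat, (N <= n)%N ->
    forall (v : T) (r : T -> nat), rev_hom lt q r ->
    forall (calF : {set {set 'I_n}}) (Gam : {set {set {set 'I_n}}}),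
      calF \subset Btilde n -> gapped l calF ->
      (q%:R - 1 + eps <= lubell calF) ->
      gl_bounded (gam / 2) l calF Gam ->
      exists2 F, F \in calF &
        (gam / 2) ^+ (#|T| - 1) *
          \prod_(e : T * T | covers lt e.1 e.2)
             (n%:R ^+ (l * `|(r e.2)%:Z - (r e.1)%:Z|%N) : R)
        <= (#|[set phi : {ffun T -> {set 'I_n}} |
               [&& ind_inj_hom lt calF phi, img phi \notin Gam & phi v == F]]|%:R : R).
Proof.
move=> q_gt0 l_gt0 eps0.
have [d d0 dP] := exists_proportion q_gt0 eps0; pose M := (l * q)%N.
have k0 : 0 < (8 ^ M * M`!)%:R :> R by rewrite ltr0n muln_gt0 expn_gt0 fact_gt0.
(* The constant of [card_step], which depends on [eps], [q] and [l] only. *)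
exists (d / (2 * (8 ^ M * M`!)%:R)); split; first by rewrite divr_gt0 // mulr_gt0.
move=> T lt k [irr tr] tree _ _.
(* At each step genericity is required against at most [#|T|] sets already chosen. *)
have [N HN] := Btilde_narrow #|T| d0; exists N => n /HN[n_gt0 [w [w_le Tw cardF cardFF]]].
move=> v r [rq rmono] calF Gam /subsetP sF gapF mu Gb.
have c_lt x : (q - r x < q)%N by have := rq x; lia.
(* Windows are indexed from the smallest set upwards, whereas [r] decreases. *)
pose c x : 'I_q := Ordinal (c_lt x).
have fact_gt0' : 0 < (n`!)%:R :> R by rewrite ltr0n fact_gt0.
have [||G [[s [t win]] G_thr]] := @cleaning R {perm 'I_n} _ set0 q (chain calF) (chain_uniq calF) d q_gt0.
- exact: ltW.
- rewrite card_Sn; apply: dP => //.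
  exact: le_trans (ler_wpM2r (ltW fact_gt0') mu) (lubell_le calF).
(* Any surviving window serves: its member at the position of [v] becomes the image of [v]. *)
pose F0 := nth set0 (chain calF s) (t + c v).
have F0F : F0 \in calF.
  have : F0 \in chain calF s.
    by move: win => /andP[sz _]; apply: mem_nth; apply: leq_trans sz; rewrite ltn_add2l.
  by rewrite mem_chain => /andP[].
exists F0 => //.
have c_mono x y : lt x y -> (c x < c y)%N.
  by move=> /rmono; have := rq x; have := rq y; rewrite /=; lia.
have F0G : (F0, c v) \in G by move: win => /andP[_ /forallP/(_ (c v))].
have := embedding_count (calF := calF) irr tr tree c_mono _ n_gt0 Gb _ F0F F0G.
rewrite /edge_wt.
rewrite (eq_bigr (fun e : T * T => n%:R ^+ (l * `|(r e.2)%:Z - (r e.1)%:Z|%N) : R)); last first.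
  move=> e _; congr (_ ^+ (_ * _)); have := rq e.1; have := rq e.2; rewrite /gap /=; lia.
apply; first by rewrite divr_gt0 // mulr_gt0.
move=> A i j L AF AG ij LF LT.
apply: (card_step gapF d0 n_gt0 (leqnn _) _ _ w_le G_thr) => //.
- by move=> B BF; apply/cardF/sF.
- by move=> B C BF CF; apply: cardFF; apply: sF.
- by apply: le_trans Tw; rewrite ler_pM2l ?ltr0n // ler_nat leq_mul2r LT orbT.
Qed.
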